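(* Let $A_1,\dots,A_m$ be real $n\times n$ matrices that leave a proper cone invariant, i.e. there exists a proper cone $K\subseteq\mathbb{R}^n$ such that $A_iK\subseteq K$ for all $i=1,\dots,m$. Then $$\frac{1}{m}\,\rho\Big(\sum_{i=1}^m A_i\Big)\;\le\;\rho(A_1,\dots,A_m)\;\le\;\rho\Big(\sum_{i=1}^m A_i\Big).$$
   Context: For a single real square matrix $A$, $\rho(A)=\lim_{k\to\infty}\|A^k\|^{1/k}$ is the spectral radius (the largest modulus of an eigenvalue). For a finite set of real $n\times n$ matrices the joint spectral radius is $$\rho(A_1,\dots,A_m)=\limsup_{k\to+\infty}\ \max_{\sigma\in\{1,\dots,m\}^k}\|A_\sigma\|^{1/k},\qquad A_\sigma=A_{\sigma_k}\cdots A_{\sigma_2}A_{\sigma_1},$$ where $\|\cdot\|$ is any matrix norm (the value does not depend on the choice). A cone in $\mathbb{R}^n$ is a subset $K\subseteq\mathbb{R}^n$ such that $\lambda v\in K$ for all $\lambda\ge 0$ and $v\in K$; a cone is proper if it is closed, convex, has nonempty interior, and contains no straight line. *)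

(* Defs.v *)
From HB Require Import structures.
From mathcomp Require Import all_boot all_order all_algebra.
From mathcomp Require Import all_classical all_reals all_analysis.

Set Implicit Arguments.
Unset Strict Implicit.
Unset Printing Implicit Defensive.

Import Order.TTheory GRing.Theory Num.Theory.
Import numFieldNormedType.Exports.

Local Open Scope classical_set_scope.
Local Open Scope ring_scope.

(* A norm on the real vector space of n x n matrices; submultiplicativity is
   not required, and nonnegativity follows from these axioms. *)
Definition matrix_norm (R : realType) (n : nat) (N : 'M[R]_n -> R) : Prop :=
  [/\ forall A B : 'M[R]_n, N (A + B) <= N A + N B,
      forall (a : R) (A : 'M[R]_n), N (a *: A) = `|a| * N A &
      forall A : 'M[R]_n, N A = 0 -> A = 0].

(* In the two sequences below the term of index 0 has exponent 0^-1 = 0; it is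
   irrelevant for the limits. *)
Definition spectral_radius (R : realType) (n : nat) (N : 'M[R]_n -> R)
    (A : 'M[R]_n) : R :=
  limn (fun k : nat => N (A ^+ k) `^ k%:R^-1).

(* A_sigma = A_(sigma_k) ... A_(sigma_2) A_(sigma_1): the first letter of sigma
   is the rightmost factor. *)
Definition mx_word (R : realType) (n m : nat) (A : 'I_m -> 'M[R]_n)
    (sigma : seq 'I_m) : 'M[R]_n :=
  \prod_(i <- rev sigma) A i.

Definition joint_spectral_radius (R : realType) (n m : nat)
    (N : 'M[R]_n -> R) (A : 'I_m -> 'M[R]_n) : R :=
  limn_sup (fun k : nat =>
    \big[Num.max/0]_(sigma : k.-tuple 'I_m) (N (mx_word A sigma) `^ k%:R^-1)).

Definition is_cone (R : realType) (n : nat) (K : set 'cV[R]_n) : Prop :=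
  forall (lambda : R) (v : 'cV[R]_n), 0 <= lambda -> K v -> K (lambda *: v).

Definition contains_line (R : realType) (n : nat) (K : set 'cV[R]_n) : Prop :=
  exists x d : 'cV[R]_n, d != 0 /\ forall t : R, K (x + t *: d).

Definition proper_cone (R : realType) (n : nat) (K : set 'cV[R]_n) : Prop :=
  [/\ is_cone K, closed K, convex_set (K : set (convex_lmodType 'cV[R]_n)),
      interior K !=set0 & ~ contains_line K].

(* Main.v *)
Require Import Defs.
From HB Require Import structures.
From mathcomp Require Import all_boot all_order all_algebra.
From mathcomp Require Import all_classical all_reals all_analysis.
From mathcomp Require Import lra.

Set Implicit Arguments.
Unset Strict Implicit.
Unset Printing Implicit Defensive.

Import Order.TTheory GRing.Theory Num.Theory.
Import numFieldNormedType.Exports.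

Local Open Scope classical_set_scope.
Local Open Scope ring_scope.

(** The upper bound is Perron-Frobenius domination. Write S for the sum of the
    matrices A_i. Expanding S ^+ k gives the sum of all words of length k, so for
    every word sigma of length k both A_sigma and S ^+ k - A_sigma map the cone K
    into itself ([cone_maps_pow_sum_sub_word]). The matrices that map K into
    itself form a closed cone of matrices; it contains no X together with - X
    other than X = 0, because K contains no line and has interior points. A closed
    pointed cone in finite dimension is normal: norms are monotone up to a
    constant for the order that it defines ([closed_pointed_cone_normal], by
    compactness of the unit sphere). Hence N (A_sigma) <= c * N (S ^+ k) with c
    independent of k and sigma, and c disappears under k-th roots.

    The lower bound is a count: S ^+ k is a sum of m ^ k words, so N (S ^+ k) is
    at most m ^ k times the largest N (A_sigma) ([matrix_norm_pow_sum_le]).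

    Both comparisons hold for every k, so it remains to pass to the limit. The
    limit superior is bounded because it is squeezed between two convergent
    sequences ([limn_sup_sandwich]), once the sequence N (S ^+ k) `^ k^-1 is known to
    converge. This is Fekete's lemma in multiplicative form
    ([cvg_root_submult]); it applies to c * N, which is submultiplicative for a
    suitable c since all norms on matrices are equivalent
    ([mx_norm_le_matrix_norm], [matrix_norm_submult]). *)

(** * The entrywise maximum norm *)

Lemma ler_mx_norm_coord (R : realType) (m n : nat) (A : 'M[R]_(m, n)) i j :
  `|A i j| <= `|A|.
Proof.
rewrite [leRHS]/Num.Def.normr /= mx_normrE.
exact: (le_bigmax 0 (fun ij : 'I_m * 'I_n => `|A ij.1 ij.2|) (i, j)).
Qed.

Lemma ler_mx_norm_mulmx (R : realType) (m n p : nat) (A : 'M[R]_(m, n))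
    (B : 'M[R]_(n, p)) : `|A *m B| <= n%:R * (`|A| * `|B|).
Proof.
rewrite {1}/Num.Def.normr /= mx_normrE; apply: bigmax_le => [|[i j] _] /=.
  by rewrite !mulr_ge0.
rewrite mxE (le_trans (ler_norm_sum _ _ _))//.
apply: (@le_trans _ _ (\sum_(k < n) `|A| * `|B|)).
  by rewrite ler_sum// => k _; rewrite normrM ler_pM// ler_mx_norm_coord.
by rewrite sumr_const card_ord -[leLHS]mulr_natl.
Qed.

(** Heine-Borel is transported from row vectors along [vec_mx], which only
    rearranges the entries and so is a homeomorphism preserving the norm. *)
Lemma mx_sphere_compact (R : realType) (m n : nat) :
  compact [set A : 'M[R]_(m, n) | `|A| = 1].
Proof.
have vec_cont : continuous (vec_mx : 'rV[R]_(m * n) -> 'M[R]_(m, n)).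
  move=> v s /= /(nbhs_ballP (vec_mx v)) [e e_gt0 es].
  apply/nbhs_ballP; exists e => //= w [_ vw]; apply: es; split => // i j.
  by rewrite !mxE; exact: vw.
have -> : [set A : 'M[R]_(m, n) | `|A| = 1] =
    vec_mx @` [set v : 'rV[R]_(m * n) | `|vec_mx v| = 1].
  apply/seteqP; split => [A /= A1|_ [v /= v1 <-]//].
  by exists (mxvec A); rewrite ?mxvecK.
apply: continuous_compact; first exact/continuous_subspaceT.
apply: bounded_closed_compact.
- exists 1; split => // M M_gt1 v /= v1; rewrite (le_trans _ (ltW M_gt1))// -v1.
  rewrite -{1}(vec_mxK v) {1}/Num.Def.normr /= mx_normrE; apply: bigmax_le => //.
  move=> [i j] _ /=; case/mxvec_indexP: j => k l; rewrite ord1 mxvecE.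
  exact: ler_mx_norm_coord.
- pose f (v : 'rV[R]_(m * n)) : R := `|vec_mx v : 'M[R]_(m, n)|.
  apply: (@preimage_closed _ _ f [set 1]); last exact: closed_eq.
  move=> v _; apply: continuous_comp; first exact: vec_cont.
  exact: (@norm_continuous R 'M[R]_(m, n)).
Qed.

(** * Roots of sequences and limits superior *)

Lemma root_exprn (R : realType) (x : R) (k : nat) : 0 <= x -> (0 < k)%N ->
  (x `^ k%:R^-1) ^+ k = x.
Proof.
move=> x_ge0 k_gt0; rewrite -powR_mulrn ?powR_ge0// -powRrM mulVf ?powRr1//.
by rewrite pnatr_eq0 -lt0n.
Qed.

Lemma exprn_root (R : realType) (x : R) (k : nat) : 0 <= x -> (0 < k)%N ->
  (x ^+ k) `^ k%:R^-1 = x.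
Proof.
move=> x_ge0 k_gt0; rewrite -powR_mulrn// -powRrM mulfV ?powRr1//.
by rewrite pnatr_eq0 -lt0n.
Qed.

Lemma cvg_root_cst (R : realType) (c : R) : 0 < c ->
  c `^ k%:R^-1 @[k --> \oo] --> (1 : R).
Proof.
move=> c0.
have inv0 : (k%:R^-1 : R) @[k --> \oo] --> (0 : R).
  by rewrite -cvg_shiftS; exact: cvg_harmonic.
have -> : (fun k : nat => c `^ k%:R^-1) = (fun k : nat => expR (k%:R^-1 * ln c)).
  by apply/funext => k; rewrite /powR gt_eqF.
have := continuous_cvg _ (@continuous_expR R (0 * ln c)) (cvgMr_tmp inv0).
rewrite mul0r expR0; apply.
Qed.

(** With k = q * p + r and r < p, submultiplicativity gives
    a k <= (a p) ^+ q * a r <= t ^+ (q * p) * a r, and only the finitely many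
    ratios a r / t ^+ r with r < p enter the constant. *)
Lemma submult_geometric_bound (R : realType) (a : nat -> R) (p : nat) (t : R) :
  (forall k, 0 <= a k) -> (forall j k, a (j + k)%N <= a j * a k) ->
  (0 < p)%N -> 0 < t -> a p <= t ^+ p ->
  exists2 M : R, 0 < M & forall k, a k <= M * t ^+ k.
Proof.
move=> a_ge0 a_sub p_gt0 t_gt0 ap.
have term_ge0 (r : 'I_p) : 0 <= a r / t ^+ r.
  by rewrite divr_ge0// exprn_ge0// ltW.
have M_gt0 : 0 < 1 + \sum_(r < p) a r / t ^+ r.
  by rewrite ltr_wpDr// sumr_ge0.
(* The summand 1 keeps the constant positive even if the sequence vanishes. *)
exists (1 + \sum_(r < p) a r / t ^+ r) => // k.
have block q r : a (q * p + r)%N <= t ^+ (q * p) * a r.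
  elim: q => [|q IHq]; first by rewrite mul0n add0n expr0 mul1r.
  rewrite mulSn -addnA (le_trans (a_sub _ _))// exprD -mulrA.
  by rewrite ler_pM.
rewrite [in leLHS](divn_eq k p) (le_trans (block _ _))//.
rewrite [in leRHS](divn_eq k p) exprD mulrCA ler_wpM2l ?exprn_ge0 ?(ltW t_gt0)//.
rewrite -ler_pdivrMr ?exprn_gt0//.
have r_lt : (k %% p < p)%N by rewrite ltn_mod.
rewrite (bigD1 (Ordinal r_lt))//= addrCA lerDl.
by rewrite addr_ge0// sumr_ge0.
Qed.

(** Fekete's lemma: the limit is the infimum of the roots of positive index. If
    the p-th root is below t, then [submult_geometric_bound] bounds the k-th
    root by t * M `^ k^-1, which tends to t. *)
Lemma cvg_root_submult (R : realType) (a : nat -> R) :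
  (forall k, 0 <= a k) -> (forall j k, a (j + k)%N <= a j * a k) ->
  cvgn (fun k => a k `^ k%:R^-1).
Proof.
move=> a_ge0 a_sub.
pose E := [set a k `^ k%:R^-1 | k in [set k | (0 < k)%N]].
have E_inf : has_inf E.
  split; first by exists (a 1%N `^ 1%:R^-1), 1%N.
  by exists 0 => _ [k _ <-]; exact: powR_ge0.
have inf_ge0 : 0 <= inf E.
  by apply: lb_le_inf E_inf.1 _ => _ [k _ <-]; exact: powR_ge0.
apply/cvg_ex; exists (inf E); apply/cvgrPdist_le => /= e e_gt0.
have e2_gt0 : 0 < e / 2 by rewrite divr_gt0.
have [_ [p p_gt0 <-] root_lt] := inf_adherent e2_gt0 E_inf.
set t := inf E + e / 2 in root_lt.
have t_gt0 : 0 < t by rewrite ltr_wpDl.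
have ap : a p <= t ^+ p.
  rewrite -[leLHS](root_exprn (a_ge0 p) p_gt0).
  by rewrite lerXn2r ?nnegrE ?powR_ge0 ?(ltW t_gt0)// ltW.
have [M M_gt0 aM] := submult_geometric_bound a_ge0 a_sub p_gt0 t_gt0 ap.
have tM : t * M `^ k%:R^-1 @[k --> \oo] --> t.
  by rewrite -[X in _ --> X]mulr1; apply: cvgMl_tmp; exact: cvg_root_cst.
have /cvgrPdist_le/(_ _ e2_gt0) near_t := tM.
near=> k.
have k_gt0 : (0 < k)%N by near: k; exists 1%N.
have inf_le : inf E <= a k `^ k%:R^-1 by apply: ge_inf; [exact: E_inf.2|exists k].
have root_le : a k `^ k%:R^-1 <= t * M `^ k%:R^-1.
  have -> : t * M `^ k%:R^-1 = (M * t ^+ k) `^ k%:R^-1.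
    rewrite powRM ?(ltW M_gt0) ?exprn_ge0 ?(ltW t_gt0)// mulrC; congr (_ * _).
    by rewrite exprn_root// ltW.
  by rewrite ge0_ler_powR ?invr_ge0 ?nnegrE ?mulr_ge0 ?exprn_ge0 ?(ltW M_gt0) ?(ltW t_gt0).
have : `|t - t * M `^ k%:R^-1| <= e / 2 by near: k.
rewrite ler_norml ler0_norm ?subr_le0// => /andP[h _].
rewrite opprB lerBlDr; move: h root_le; rewrite /t; lra.
Unshelve. all: by end_near. Qed.

(** The real-valued [limn_sup] is meaningful only for bounded sequences; the outer
    sequences provide the bounds. *)
Lemma limn_sup_sandwich (R : realType) (v b w : nat -> R) :
  (forall k, v k <= b k) -> (forall k, b k <= w k) -> cvgn v -> cvgn w ->
  limn v <= limn_sup b /\ limn_sup b <= limn w.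
Proof.
move=> vb bw cv cw.
have ub_w := bounded_fun_has_ubound (cvg_seq_bounded cw).
have ub_b : has_ubound (range b).
  have [M wM] := ub_w; exists M => _ [k _ <-].
  by rewrite (le_trans (bw k))// wM//; exists k.
have lb_b : has_lbound (range b).
  have [M vM] := bounded_fun_has_lbound (cvg_seq_bounded cv).
  exists M => _ [k _ <-].
  by rewrite (le_trans _ (vb k))// vM//; exists k.
have cb : cvgn (sups b) by apply/cvg_ex; eexists; exact: cvg_sups_inf.
rewrite -(cvg_limn_supE cw); split; apply: ler_lim => //.
- apply: nearW => k; rewrite (le_trans (vb k))//.
  by apply: ub_le_sup; [exact/has_ubound_sdrop|exists k => /=].
- exact: is_cvg_sups.
- apply: nearW => k; apply: ge_sup; first by exists (b k), k => /=.
  move=> _ /= [j kj <-]; rewrite (le_trans (bw j))//.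
  by apply: ub_le_sup; [exact/has_ubound_sdrop|exists j].
Qed.

(** * Norms on matrices *)

Section MatrixNorm.
Context (R : realType) (n : nat) (N : 'M[R]_n -> R).
Hypothesis normN : matrix_norm N.

Let N_triangle A B : N (A + B) <= N A + N B. Proof. by case: normN. Qed.
Let N_scale a A : N (a *: A) = `|a| * N A. Proof. by case: normN. Qed.

Lemma matrix_norm0 : N 0 = 0.
Proof. by rewrite -(scale0r 0) N_scale normr0 mul0r. Qed.

Lemma matrix_normN A : N (- A) = N A.
Proof. by rewrite -scaleN1r N_scale normrN1 mul1r. Qed.

Lemma matrix_norm_ge0 A : 0 <= N A.
Proof.
have := N_triangle A (- A); rewrite subrr matrix_norm0 matrix_normN; lra.
Qed.

Lemma matrix_norm_sum (I : Type) (r : seq I) (F : I -> 'M[R]_n) :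
  N (\sum_(i <- r) F i) <= \sum_(i <- r) N (F i).
Proof.
elim/big_rec2 : _ => [|i y x _ IH]; first by rewrite matrix_norm0.
by rewrite (le_trans (N_triangle _ _))// lerD2l.
Qed.

Lemma matrix_norm_le_mx_norm : exists2 c, 0 < c & forall A, N A <= c * `|A|.
Proof.
pose d := \sum_i \sum_j N (delta_mx i j).
have d_ge0 : 0 <= d by do 2!rewrite sumr_ge0// => *; exact: matrix_norm_ge0.
exists (d + 1) => [|A]; first by rewrite ltr_wpDl.
apply: (@le_trans _ _ (d * `|A|)); last by rewrite ler_wpM2r// lerDl.
rewrite {1}(matrix_sum_delta A) (le_trans (matrix_norm_sum _ _))//.
rewrite mulr_suml ler_sum// => i _; rewrite (le_trans (matrix_norm_sum _ _))//.
rewrite mulr_suml ler_sum// => j _; rewrite N_scale mulrC.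
by rewrite ler_wpM2l ?matrix_norm_ge0// ler_mx_norm_coord.
Qed.

Lemma matrix_norm_continuous : continuous N.
Proof.
have [c c_gt0 Nc] := matrix_norm_le_mx_norm.
move=> A s /= /(nbhs_ballP (N A)) [e e_gt0 es].
apply/nbhs_ballP; exists (e / c) => [|B]; first exact: divr_gt0.
rewrite -ball_normE /= ltr_pdivlMr// mulrC => AB; apply: es.
have NB := le_lt_trans (Nc _) AB.
rewrite -ball_normE /= (le_lt_trans _ NB)// ler_norml.
have := N_triangle (A - B) B; have := N_triangle (B - A) A.
rewrite !subrK -(opprB A B) matrix_normN; lra.
Qed.

(** N is continuous and positive on the compact unit sphere, hence bounded below
    there by a positive constant. Compactness is used as a near-covering property
    rather than through a minimum because the sphere is empty when n = 0. *)
Lemma mx_norm_le_matrix_norm : exists2 c, 0 < c & forall A, `|A| <= c * N A.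
Proof.
have [c c_gt0 Nc] : exists2 c, 0 < c & forall A, `|A| = 1 -> c < N A.
  have /compact_near_coveringP sphere := @mx_sphere_compact R n n.
  have away : \forall c \near (0 : R)^'+, [set A : 'M[R]_n | `|A| = 1] `<=`
      (fun A => c < N A).
    apply: sphere => A /= A1.
    have NA_gt0 : 0 < N A.
      rewrite lt_neqAle matrix_norm_ge0 andbT eq_sym; apply/eqP => NA0.
      have [_ _ /(_ A NA0) A0] := normN.
      by move: A1; rewrite A0 normr0 => /esym/eqP; rewrite oner_eq0.
    have NA2 : 0 < N A / 2 by rewrite divr_gt0.
    near=> B c => /=; apply: (@lt_trans _ _ (N A / 2)).
      by near: c; exact: nbhs_right_lt.
    near: B; apply: (cvgr_gt (N A)); first exact: matrix_norm_continuous.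
    by rewrite ltr_pdivrMr// ltr_pMr// ltr1n.
  near (0 : R)^'+ => c; exists c; first by near: c; exact: nbhs_right_gt.
  by near: c.
exists c^-1 => [|A]; first by rewrite invr_gt0.
have [->|A_neq0] := eqVneq A 0; first by rewrite normr0 matrix_norm0 mulr0.
have A_gt0 : 0 < `|A| by rewrite normr_gt0.
have /Nc : `|(`|A|^-1 *: A)| = 1.
  by rewrite normrZ normfV normr_id mulVf// gt_eqF.
rewrite N_scale normfV normr_id ler_pdivlMl// => /ltW.
by rewrite ler_pdivlMl// mulrC.
Unshelve. all: by end_near. Qed.

Lemma matrix_norm_submult :
  exists2 c, 0 < c & forall A B, N (A * B) <= c * N A * N B.
Proof.
have [c1 c1_gt0 N_le] := matrix_norm_le_mx_norm.
have [c2 c2_gt0 le_N] := mx_norm_le_matrix_norm.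
exists (c1 * n.+1%:R * c2 * c2) => [|A B]; first by rewrite !mulr_gt0.
rewrite (le_trans (N_le _))// -!mulrA ler_wpM2l ?(ltW c1_gt0)//.
have AB : `|A * B| <= n.+1%:R * (`|A| * `|B|).
  by rewrite (le_trans (ler_mx_norm_mulmx _ _))// ler_wpM2r ?mulr_ge0// ler_nat.
rewrite (le_trans AB)// ler_wpM2l//.
by rewrite [leRHS](_ : _ = (c2 * N A) * (c2 * N B)) ?ler_pM//; lra.
Qed.

(** A constant multiple c * N is submultiplicative, and c `^ k^-1 tends to 1. *)
Lemma cvg_spectral_radius A : cvgn (fun k : nat => N (A ^+ k) `^ k%:R^-1).
Proof.
have [c c_gt0 Nc] := matrix_norm_submult.
pose a k := c * N (A ^+ k).
have a_ge0 k : 0 <= a k by rewrite mulr_ge0 ?matrix_norm_ge0// ltW.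
have a_sub j k : a (j + k)%N <= a j * a k.
  by rewrite /a exprD -[leRHS]mulrA ler_wpM2l ?(ltW c_gt0)// mulrCA [leRHS]mulrA Nc.
have -> : (fun k : nat => N (A ^+ k) `^ k%:R^-1) =
    (fun k : nat => c^-1 `^ k%:R^-1 * a k `^ k%:R^-1).
  apply/funext => k.
  by rewrite -powRM ?invr_ge0 ?(ltW c_gt0)// mulKf// gt_eqF.
apply: is_cvgM; last exact: cvg_root_submult.
by apply/cvg_ex; exists 1; apply: cvg_root_cst; rewrite invr_gt0.
Qed.

End MatrixNorm.

(** * Cones and the matrices that preserve them *)

Lemma convex_cone_add (R : realType) (n : nat) (K : set 'cV[R]_n) :
  is_cone K -> convex_set (K : set (convex_lmodType 'cV[R]_n)) ->
  forall v w, K v -> K w -> K (v + w).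
Proof.
move=> coneK convK v w Kv Kw.
(* v + w is twice the midpoint of v and w. *)
have half : K (2^-1 *: v + (1 - 2^-1) *: w).
  have half_ge0 : 0 <= 2^-1 :> R by lra.
  have half_le1 : 2^-1 <= 1 :> R by lra.
  exact: set_mem (convK v w (Itv01 half_ge0 half_le1) (mem_set Kv) (mem_set Kw)).
have := coneK 2 _ (ler0n _ 2) half.
by rewrite scalerDr !scalerA mulrBr mulr1 divff ?pnatr_eq0// addrK !scale1r.
Qed.

Lemma line_free_cone_pointed (R : realType) (n : nat) (K : set 'cV[R]_n) :
  is_cone K -> ~ contains_line K -> forall v, K v -> K (- v) -> v = 0.
Proof.
move=> coneK no_line v Kv KNv; apply: contrapT => /eqP v_neq0.
apply: no_line; exists 0, v; split=> // t; rewrite add0r.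
have [t_ge0|t_lt0] := leP 0 t; first exact: coneK.
by rewrite -[t]opprK scaleNr -scalerN; apply: coneK; rewrite ?oppr_ge0 ?(ltW t_lt0).
Qed.

(** By homogeneity it suffices to bound `|Y| from below when `|X| = 1. If X is in C
    then - X lies in the open complement of C, so Y - X' is outside C for X' near X
    and Y small; compactness of the sphere makes the bound on
    Y uniform. *)
Lemma closed_pointed_cone_normal (R : realType) (m n : nat)
    (C : set 'M[R]_(m, n)) :
  (forall (a : R) X, 0 <= a -> C X -> C (a *: X)) -> closed C ->
  (forall X, C X -> C (- X) -> X = 0) ->
  exists2 c : R, 0 < c & forall X Y, C X -> C (Y - X) -> `|X| <= c * `|Y|.
Proof.
move=> coneC closedC pointedC.
have [e e_gt0 far] : exists2 e : R, 0 < e &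
    forall X Y, `|X| = 1 -> C X -> C (Y - X) -> e <= `|Y|.
  have /compact_near_coveringP sphere := @mx_sphere_compact R m n.
  have away : \forall e \near (0 : R)^'+, [set X : 'M[R]_(m, n) | `|X| = 1] `<=`
      (fun X => C X -> forall Y, C (Y - X) -> e <= `|Y|).
    apply: sphere => X /= X1.
    have [CX|nCX] := pselect (C X); last first.
      have /nbhs_ballP[d /= d_gt0 dC] : nbhs X (~` C).
        by apply: open_nbhs_nbhs; split=> //; exact: closed_openC.
      near=> X' e => /= CX'; exfalso; apply: (dC X') => //.
      by near: X'; exact: nbhsx_ballx.
    have nCNX : ~ C (- X).
      move=> CNX; move: X1; rewrite (pointedC X)// normr0 => /esym/eqP.
      by rewrite oner_eq0.
    have /nbhs_ballP[d /= d_gt0 dC] : nbhs (- X) (~` C).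
      by apply: open_nbhs_nbhs; split=> //; exact: closed_openC.
    have d2_gt0 : 0 < d / 2 by rewrite divr_gt0.
    (* A small Y would put Y - X' within d of - X, where C has no point. *)
    near=> X' e => /= CX' Y CY; rewrite leNgt; apply/negP => Y_lt.
    apply: (dC (Y - X')) => //; rewrite -ball_normE /=.
    have X'_near : `|X - X'| < d / 2.
      suff : ball X (d / 2) X' by rewrite -ball_normE.
      by near: X'; exact: nbhsx_ballx.
    have e_lt : e < d / 2 by near: e; exact: nbhs_right_lt.
    have -> : - X - (Y - X') = - (Y + (X - X')).
      by rewrite opprB !opprD opprK [LHS]addrA [RHS]addrC.
    rewrite normrN (le_lt_trans (ler_normD _ _))//; lra.
  near (0 : R)^'+ => e; exists e; first by near: e; exact: nbhs_right_gt.
  have sub_e : [set X : 'M[R]_(m, n) | `|X| = 1] `<=`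
      (fun X => C X -> forall Y, C (Y - X) -> e <= `|Y|) by near: e.
  by move=> X Y X1 CX; exact: sub_e.
exists e^-1 => [|X Y CX CYX]; first by rewrite invr_gt0.
have [->|X_neq0] := eqVneq X 0; first by rewrite normr0 mulr_ge0// invr_ge0 ltW.
have X_gt0 : 0 < `|X| by rewrite normr_gt0.
have := far (`|X|^-1 *: X) (`|X|^-1 *: Y).
rewrite -scalerBr !normrZ normfV normr_id mulVf ?gt_eqF//.
move=> /(_ erefl (coneC _ _ _ CX) (coneC _ _ _ CYX)).
by rewrite invr_ge0 normr_ge0 ler_pdivlMl// => /(_ isT isT); rewrite ler_pdivlMl// mulrC.
Unshelve. all: by end_near. Qed.

Definition cone_maps (R : realType) (n : nat) (K : set 'cV[R]_n) : set 'M[R]_n :=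
  [set X | forall v, K v -> K (X *m v)].

Section ConeMaps.
Context (R : realType) (n : nat) (K : set 'cV[R]_n).
Hypothesis properK : proper_cone K.

Lemma cone_mapsZ (a : R) X : 0 <= a -> cone_maps K X -> cone_maps K (a *: X).
Proof.
have [coneK _ _ _ _] := properK.
by move=> a_ge0 KX v Kv; rewrite -scalemxAl; apply: coneK => //; exact: KX.
Qed.

Lemma cone_mapsD X Y : cone_maps K X -> cone_maps K Y -> cone_maps K (X + Y).
Proof.
have [coneK _ convK _ _] := properK.
move=> KX KY v Kv; rewrite mulmxDl.
by apply: convex_cone_add => //; [exact: KX|exact: KY].
Qed.

Lemma cone_mapsM X Y : cone_maps K X -> cone_maps K Y -> cone_maps K (X * Y).
Proof. by move=> KX KY v Kv; rewrite -mulmxA; apply/KX/KY. Qed.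

Lemma cone_maps0 : cone_maps K 0.
Proof.
by have [coneK _ _ _ _] := properK => v Kv; rewrite mul0mx -(scale0r v); exact: coneK.
Qed.

Lemma cone_maps1 : cone_maps K 1.
Proof. by move=> v Kv; rewrite mul1mx. Qed.

Lemma cone_maps_sum (I : Type) (r : seq I) (P : pred I) (F : I -> 'M[R]_n) :
  (forall i, P i -> cone_maps K (F i)) -> cone_maps K (\sum_(i <- r | P i) F i).
Proof.
by move=> KF; elim/big_ind : _ => //; [exact: cone_maps0|exact: cone_mapsD].
Qed.

Lemma cone_mapsX X k : cone_maps K X -> cone_maps K (X ^+ k).
Proof.
move=> KX; elim: k => [|k IHk]; first exact: cone_maps1.
by rewrite exprS; exact: cone_mapsM.
Qed.

Lemma cone_maps_closed : closed (cone_maps K).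
Proof.
have [_ closedK _ _ _] := properK.
have -> : cone_maps K = \bigcap_(v in K) ((fun X : 'M[R]_n => X *m v) @^-1` K).
  by apply/seteqP; split=> [X KX v Kv|X KX v Kv]; exact: KX.
apply: closed_bigI => v Kv.
apply: (@preimage_closed _ _ (fun X : 'M[R]_n => X *m v) K) => // X _.
move=> s /= /(nbhs_ballP (X *m v)) [e e_gt0 es].
pose d := n%:R * `|v| + 1.
have d_gt0 : 0 < d by rewrite ltr_wpDl// mulr_ge0.
apply/nbhs_ballP; exists (e / d) => [|Y]; first exact: divr_gt0.
rewrite -ball_normE /= ltr_pdivlMr// => XY; apply: es.
rewrite -ball_normE /= -mulmxBl (le_lt_trans (ler_mx_norm_mulmx _ _))//.
by rewrite (le_lt_trans _ XY)// mulrCA ler_wpM2l// lerDl.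
Qed.

(** If X and - X both preserve K then X v = 0 for every v in K, since K is
    pointed; K has interior points, hence spans the space. *)
Lemma cone_maps_pointed X : cone_maps K X -> cone_maps K (- X) -> X = 0.
Proof.
have [coneK _ _ [e /nbhs_ballP[r /= r_gt0 ballK]] no_line] := properK.
move=> KX KNX.
have X_vanish v : K v -> X *m v = 0.
  move=> Kv; apply: (line_free_cone_pointed coneK no_line); first exact: KX.
  by rewrite -mulNmx; exact: KNX.
have Xe : X *m e = 0 by apply/X_vanish/ballK/ballxx.
have X_zero (d : 'cV[R]_n) : X *m d = 0.
  (* The scale s is small enough for e + s *: d to stay in the ball inside K. *)
  pose s := r / (`|d| + 1).
  have d1_gt0 : 0 < `|d| + 1 by rewrite ltr_wpDl.
  have s_gt0 : 0 < s by rewrite divr_gt0.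
  have : X *m (e + s *: d) = 0.
    apply/X_vanish/ballK; rewrite -ball_normE /= opprD addrA subrr add0r normrN.
    rewrite normrZ gtr0_norm// /s mulrAC ltr_pdivrMr// ltr_pM2l// ltrDl.
    exact: ltr01.
  rewrite mulmxDr Xe add0r -scalemxAr => /eqP.
  by rewrite scaler_eq0 gt_eqF//= => /eqP.
apply/matrixP => i j.
by have /matrixP/(_ i 0) := X_zero (delta_mx j 0); rewrite -colE !mxE.
Qed.

(** Normality of the cone of matrices preserving K, carried over from the
    entrywise maximum norm to N by equivalence of norms. *)
Lemma cone_maps_matrix_norm_monotone (N : 'M[R]_n -> R) : matrix_norm N ->
  exists2 c : R, 0 < c &
    forall X Y, cone_maps K X -> cone_maps K (Y - X) -> N X <= c * N Y.
Proof.
move=> normN.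
have [c c_gt0 Xc] := closed_pointed_cone_normal cone_mapsZ cone_maps_closed cone_maps_pointed.
have [c1 c1_gt0 N_le] := matrix_norm_le_mx_norm normN.
have [c2 c2_gt0 le_N] := mx_norm_le_matrix_norm normN.
exists (c1 * (c * c2)) => [|X Y KX KYX]; first by rewrite !mulr_gt0.
rewrite (le_trans (N_le _))// -!mulrA ler_wpM2l ?(ltW c1_gt0)//.
by rewrite (le_trans (Xc X Y KX KYX))// ler_wpM2l ?(ltW c_gt0).
Qed.

End ConeMaps.

(** * Powers of the sum and words *)

Lemma mx_word_cons (R : realType) (n m : nat) (A : 'I_m -> 'M[R]_n) i sigma :
  mx_word A (i :: sigma) = mx_word A sigma * A i.
Proof. by rewrite /mx_word rev_cons -cats1 big_cat big_seq1. Qed.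

(** The difference is the sum of all other words of the same length. Induction on
    the word avoids that expansion: with S the sum, P the power of S matching the
    word W, one has P S - W A_i = P (S - A_i) + (P - W) A_i, and all four factors
    preserve K. *)
Lemma cone_maps_pow_sum_sub_word (R : realType) (n m : nat) (K : set 'cV[R]_n)
    (A : 'I_m -> 'M[R]_n) (sigma : seq 'I_m) :
  proper_cone K -> (forall i, cone_maps K (A i)) ->
  cone_maps K (mx_word A sigma) /\
  cone_maps K ((\sum_i A i) ^+ size sigma - mx_word A sigma).
Proof.
move=> properK KA; elim: sigma => [|i sigma [IHw IHd]].
  rewrite /mx_word big_nil expr0 subrr.
  by split; [exact: cone_maps1|exact: cone_maps0].
rewrite mx_word_cons; split; first exact: cone_mapsM.
rewrite /= exprSr; set S := \sum_i A i in IHd *.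
have -> : S ^+ size sigma * S - mx_word A sigma * A i =
    S ^+ size sigma * (S - A i) + (S ^+ size sigma - mx_word A sigma) * A i.
  by rewrite mulrBr mulrBl addrA subrK.
apply: cone_mapsD => //; apply: cone_mapsM => //.
  by apply: cone_mapsX; exact: cone_maps_sum.
rewrite /S (bigD1 i)//= addrC addrK.
exact: cone_maps_sum.
Qed.

(** The right factor X absorbs the letters already split off from the power, which
    makes induction on k possible without expanding the power into words. *)
Lemma matrix_norm_pow_sum_le (R : realType) (n m : nat) (N : 'M[R]_n -> R)
    (A : 'I_m -> 'M[R]_n) (k : nat) (X : 'M[R]_n) (M : R) : matrix_norm N ->
  (forall sigma : k.-tuple 'I_m, N (mx_word A sigma * X) <= M) ->
  N ((\sum_i A i) ^+ k * X) <= m%:R ^+ k * M.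
Proof.
move=> normN; elim: k X => [|k IHk] X word_le.
  by have := word_le [tuple]; rewrite /mx_word big_nil !expr0 !mul1r.
rewrite exprSr -mulrA mulr_suml mulr_sumr.
rewrite (le_trans (matrix_norm_sum normN _ _))//.
apply: (@le_trans _ _ (\sum_(i < m) m%:R ^+ k * M)).
  apply: ler_sum => i _; apply: IHk => sigma.
  by have := word_le [tuple of i :: sigma]; rewrite mx_word_cons mulrA.
by rewrite sumr_const card_ord -[leLHS]mulr_natl exprS mulrA.
Qed.

Theorem theorem1 (R : realType) (n m : nat) (m_gt0 : (0 < m)%N)
    (N : 'M[R]_n -> R) (normN : matrix_norm N)
    (A : 'I_m -> 'M[R]_n)
    (invA : exists K : set 'cV[R]_n,
      proper_cone K /\ forall i : 'I_m, (fun v => A i *m v) @` K `<=` K) :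
  m%:R^-1 * spectral_radius N (\sum_(i < m) A i) <= joint_spectral_radius N A
  /\ joint_spectral_radius N A <= spectral_radius N (\sum_(i < m) A i).
Proof.
have [K [properK AK]] := invA.
have KA i : cone_maps K (A i) by move=> v Kv; apply: (AK i); exists v.
have [c c_gt0 Nc] := cone_maps_matrix_norm_monotone properK normN.
have m_gt0R : 0 < m%:R :> R by rewrite ltr0n.
set S := \sum_(i < m) A i.
have cvg_u := @cvg_spectral_radius _ _ _ normN S.
set u := (fun k : nat => N (S ^+ k) `^ k%:R^-1) in cvg_u.
set b := (fun k : nat =>
  \big[Num.max/0]_(sigma : k.-tuple 'I_m) (N (mx_word A sigma) `^ k%:R^-1)).
have lower k : m%:R^-1 * u k <= b k.
  have root_le (sigma : k.-tuple 'I_m) : N (mx_word A sigma) `^ k%:R^-1 <= b k.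
    exact: (le_bigmax 0
      (fun s : k.-tuple 'I_m => N (mx_word A s) `^ k%:R^-1) sigma).
  pose sigma0 := nseq_tuple k (Ordinal m_gt0).
  have [k0|k_gt0] := posnP k.
    (* The exponent is 0^-1 = 0, so every root involved equals 1. *)
    have := root_le sigma0; rewrite /u.
    have -> : k%:R^-1 = 0 :> R by rewrite k0 invr0.
    by rewrite !powRr0 mulr1; apply: le_trans; rewrite invf_le1// ler1n.
  have b_ge0 : 0 <= b k by rewrite (le_trans _ (root_le sigma0))// powR_ge0.
  have word_le (sigma : k.-tuple 'I_m) : N (mx_word A sigma * 1) <= b k ^+ k.
    rewrite mulr1 -[leLHS](root_exprn (matrix_norm_ge0 normN _) k_gt0).
    by rewrite lerXn2r ?nnegrE ?powR_ge0.
  have := matrix_norm_pow_sum_le normN word_le.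
  rewrite mulr1 -exprMn -/S => NS_le; rewrite ler_pdivrMl//.
  have mb_ge0 : 0 <= m%:R * b k by rewrite mulr_ge0 ?(ltW m_gt0R).
  rewrite -[leRHS](exprn_root mb_ge0 k_gt0) /u.
  by rewrite ge0_ler_powR ?invr_ge0 ?nnegrE ?exprn_ge0 ?(matrix_norm_ge0 normN).
have upper k : b k <= c `^ k%:R^-1 * u k.
  apply: bigmax_le => [|sigma _]; first by rewrite mulr_ge0 ?powR_ge0.
  have [Kw Kd] := cone_maps_pow_sum_sub_word sigma properK KA.
  rewrite size_tuple in Kd.
  rewrite -powRM ?(ltW c_gt0) ?(matrix_norm_ge0 normN)//.
  rewrite ge0_ler_powR ?invr_ge0 ?nnegrE ?mulr_ge0 ?(ltW c_gt0)
    ?(matrix_norm_ge0 normN)//.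
  exact: Nc.
have cvg_lower : m%:R^-1 * u k @[k --> \oo] --> m%:R^-1 * limn u.
  exact: (cvgMl_tmp cvg_u).
have cvg_upper : c `^ k%:R^-1 * u k @[k --> \oo] --> limn u.
  by rewrite -[X in _ --> X]mul1r; apply: cvgM; [exact: cvg_root_cst|].
have := limn_sup_sandwich lower upper (cvgP _ cvg_lower) (cvgP _ cvg_upper).
by rewrite (cvg_lim _ cvg_lower)// (cvg_lim _ cvg_upper).
Qed.
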